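(* Let $n\ge2$ be an integer and $p$ a prime. There exist constants $c_0,c_1,c_2,c_3>0$ depending only on $n$ and $p$ such that for every $0\le\nu\le n-1$ and all sufficiently large $Q$, the number of polynomials $P\in\mathbb{Z}[x]$ of degree $n$, irreducible over $\mathbb{Q}$, with $c_1Q\le H(P)\le c_2 Q$ and $$0<|D(P)|_p\le c_0\,Q^{-2\nu}$$ is at least $c_3\,Q^{\,n+1-\frac{n+2}{n}\nu}$.
   Context: For $P=a_nx^n+\dots+a_0\in\mathbb{Z}[x]$ with $a_n\ne0$, $H(P)=\max_i|a_i|$ is its height and its discriminant is $D(P)=a_n^{2n-2}\prod_{1\le i<j\le n}(\alpha_i-\alpha_j)^2$, where $\alpha_1,\dots,\alpha_n$ are the roots of $P$ with multiplicity; $D(P)\in\mathbb{Z}$. $|\cdot|_p$ denotes the $p$-adic absolute value. *)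

(* Defs.v *)
From HB Require Import structures.
From mathcomp Require Import all_boot all_order all_algebra all_field.
From mathcomp Require Import finmap.
From mathcomp Require Import all_classical all_reals all_analysis.
Set Implicit Arguments.
Unset Strict Implicit.
Unset Printing Implicit Defensive.
Import Order.TTheory GRing.Theory Num.Theory.
Import numFieldNormedType.Exports.
Local Open Scope ring_scope.

Definition height (P : {poly int}) : nat := (\max_(i < size P) absz (P`_i)%R)%N.

(* The complex roots of P (P != 0), listed with multiplicity. *)
Definition croots (P : {poly int}) : seq algC :=
  sval (closed_field_poly_normal (map_poly intr P : {poly algC})).

(* The product is symmetric in the roots, so the order of croots P is
   immaterial. The value is an algebraic number that is in fact an integer. *)
Definition discr (P : {poly int}) : algC :=
  let n := (size P).-1 in
  (lead_coef P)%:~R ^+ (2 * n - 2) *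
  \prod_(i < n) \prod_(j < n | (i < j)%N)
    ((croots P)`_i - (croots P)`_j) ^+ 2.

Definition padic_abs (R : realType) (p : nat) (m : int) : R :=
  if m == 0 then 0 else p%:R ^- logn p `|m|%N.
Arguments padic_abs : clear implicits.

Definition small_discr_polys (R : realType) (n p : nat) (c0 c1 c2 nu Q : R) :
    set {poly int} :=
  [set P : {poly int} |
    [/\ size P = n.+1,
        irreducible_poly (map_poly intr P : {poly rat}),
        c1 * Q <= (height P)%:R <= c2 * Q
      & exists2 D : int, D%:~R = discr P
          & 0 < padic_abs R p D <= c0 * Q `^ (- (2 * nu))] ]%classic.

(* Main.v *)
Require Import Defs.
From HB Require Import structures.
From mathcomp Require Import all_boot all_order all_algebra all_field.
From mathcomp Require Import finmap.
From mathcomp Require Import all_classical all_reals all_analysis.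
From mathcomp Require Import fingroup perm zify ring lra.
Import Order.TTheory GRing.Theory Num.Theory.
Import numFieldNormedType.Exports.
Local Open Scope ring_scope.

(** Put t = p^k. A polynomial with a p-adic unit leading coefficient whose n
    roots all lie in one p-adic disc of radius t^-2 has discriminant divisible
    by t^(2n(n-1)). The polynomials whose roots lie in the disc around -u/v form
    the n-th symmetric power of the lattice of linear forms generated by
    l1 = v X + u and l2 = v2 X + u2, where v u2 - v2 u = t^2. If u and v are
    coprime, at most t, and v is at least t/16, then l1 and l2 can be chosen with
    coefficients O(t), so the sums of b_i l1^i l2^(n-i) with b_i = O(Q / t^n)
    have height O(Q). When the b_i are the coefficients of a p-Eisenstein
    polynomial, so is the polynomial obtained by rescaling the disc to the unit
    disc, which gives irreducibility. Distinct pairs (u, v) give disjoint discs,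
    and there are at least t^2/16 of them, so with t ~ Q^(nu/(n(n-1))) one gets
    about t^2 (Q/t^n)^(n+1) = Q^(n+1-(n+2)nu/n) polynomials. *)

Set Implicit Arguments.
Unset Strict Implicit.

(** * Discriminants through the roots *)

(** The discriminant of the monic polynomial with root list [s]; the power of the leading
    coefficient is kept apart. *)
Definition sq_diffs (s : seq algC) : algC :=
  \prod_(i < size s) \prod_(j < size s | (i < j)%N) (s`_i - s`_j) ^+ 2.

Lemma sq_diffs_cons (x : algC) (s : seq algC) :
  sq_diffs (x :: s) = (\prod_(y <- s) (x - y) ^+ 2) * sq_diffs s.
Proof.
rewrite /sq_diffs /= big_ord_recl /= big_mkcond /= big_ord_recl /= mul1r.
congr (_ * _); first by rewrite (big_nth 0) big_mkord.
apply: eq_bigr => i _.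
by rewrite big_mkcond big_ord_recl /= mul1r [RHS]big_mkcond.
Qed.

(** The derivative of [(X - x) g] takes the value [g(x)] at [x] and [(y - x) g'(y)] at a root [y] of
    [g], so induction on the list collects each pair of roots twice with opposite signs. *)
Lemma prod_deriv_roots (s : seq algC) :
  \prod_(x <- s) (\prod_(y <- s) ('X - y%:P))^`().[x] =
    (-1) ^+ 'C(size s, 2) * sq_diffs s.
Proof.
elim: s => [|x s IHs]; first by rewrite big_nil /sq_diffs big_ord0 mulr1.
rewrite big_cons big_cons derivM derivXsubC mul1r.
rewrite !hornerE subrr mul0r addr0 horner_prod.
under eq_bigr do rewrite hornerXsubC.
rewrite sq_diffs_cons.
have -> : \prod_(y <- s) (\prod_(j <- s) ('X - j%:P) +
      ('X - x%:P) * (\prod_(j <- s) ('X - j%:P))^`()).[y] =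
    \prod_(y <- s) ((y - x) * (\prod_(j <- s) ('X - j%:P))^`().[y]).
  apply: eq_big_seq => y sy; rewrite hornerD hornerM hornerXsubC.
  suff -> : (\prod_(j <- s) ('X - j%:P)).[y] = 0 by rewrite add0r.
  by apply/rootP; rewrite root_prod_XsubC.
rewrite big_split /= IHs binS bin1 exprD.
have -> : \prod_(y <- s) (y - x) = (-1) ^+ size s * \prod_(y <- s) (x - y).
  elim: s {IHs} => [|z s IHs]; first by rewrite !big_nil mulr1.
  by rewrite !big_cons IHs exprS; ring.
by rewrite prodrXl expr2; ring.
Qed.

(** The product of the derivatives at the roots is visibly symmetric, unlike the product over
    [i < j]. *)
Lemma sq_diffs_perm (s1 s2 : seq algC) :
  perm_eq s1 s2 -> sq_diffs s1 = sq_diffs s2.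
Proof.
move=> s12.
have signE s : sq_diffs s = (-1) ^+ 'C(size s, 2) *
    \prod_(x <- s) (\prod_(y <- s) ('X - y%:P))^`().[x].
  by rewrite prod_deriv_roots mulrA -exprD addnn -mul2n exprM sqrrN !expr1n mul1r.
by rewrite !signE (perm_size s12) !(perm_big _ s12).
Qed.

Lemma sq_diffs_affine (a b : algC) (s : seq algC) :
  sq_diffs [seq a + b * x | x <- s] =
    b ^+ (size s * (size s).-1) * sq_diffs s.
Proof.
elim: s => [|x s IHs]; first by rewrite mul1r.
rewrite /= !sq_diffs_cons IHs big_map /= !prodrXl.
have -> : \prod_(y <- s) (a + b * x - (a + b * y)) =
    b ^+ size s * \prod_(y <- s) (x - y).
  elim: s {IHs} => [|z s IHs]; first by rewrite !big_nil mulr1.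
  by rewrite !big_cons IHs exprS; ring.
have -> : ((size s).+1 * size s = size s * 2 + size s * (size s).-1)%N.
  by case: (size s) => //= m; rewrite -mulnDr mulnC; congr (_ * _)%N; lia.
by rewrite exprD (exprM b _ 2); ring.
Qed.

Lemma sq_diffs_neq0 (s : seq algC) : uniq s -> sq_diffs s != 0.
Proof.
elim: s => [|x s IHs]; first by rewrite /sq_diffs big_ord0 oner_eq0.
rewrite sq_diffs_cons /= => /andP[xs us]; rewrite mulf_neq0 ?IHs //.
rewrite prodf_seq_neq0; apply/allP => y ys /=.
by rewrite expf_neq0 // subr_eq0; apply: contraNneq xs => ->.
Qed.

Lemma crootsP (P : {poly int}) : P != 0 ->
  map_poly intr P = (lead_coef P)%:~R *: \prod_(x <- croots P) ('X - x%:P)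
    :> {poly algC}.
Proof.
move=> P0; rewrite /croots; case: closed_field_poly_normal => s /= ->.
by rewrite lead_coef_map_inj //; exact: intr_inj.
Qed.

Lemma size_croots (P : {poly int}) : P != 0 -> size (croots P) = (size P).-1.
Proof.
move=> P0; have := congr1 (size \o polyseq) (crootsP P0) => /=.
rewrite size_map_poly_id0; last by rewrite intr_eq0 lead_coef_eq0.
by rewrite size_scale ?size_prod_XsubC ?intr_eq0 ?lead_coef_eq0 // => ->.
Qed.

Lemma discrE (P : {poly int}) : P != 0 ->
  discr P = (lead_coef P)%:~R ^+ (2 * (size P).-1 - 2) * sq_diffs (croots P).
Proof. by move=> P0; rewrite /discr /sq_diffs size_croots. Qed.

(** In characteristic 0 the derivative of an irreducible polynomial is nonzero and of smaller
    degree, hence coprime to it, so the complex roots are distinct. *)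
Lemma discr_neq0 (P : {poly int}) :
  irreducible_poly (map_poly intr P : {poly rat}) -> discr P != 0.
Proof.
move=> irrP; have P0 : P != 0.
  by apply: contraTneq (irrP.1) => ->; rewrite map_poly0 size_poly0.
rewrite discrE // mulf_neq0 ?expf_neq0 ?intr_eq0 ?lead_coef_eq0 //.
apply: sq_diffs_neq0; rewrite -separable_prod_XsubC.
have l0 : (lead_coef P)%:~R != 0 :> algC by rewrite intr_eq0 lead_coef_eq0.
have := eqp_separable (eqp_scale (\prod_(x <- croots P) ('X - x%:P)) l0).
move=> <-; rewrite -crootsP //.
have -> : map_poly intr P = map_poly ratr (map_poly intr P : {poly rat})
    :> {poly algC}.
  by rewrite -map_poly_comp; apply: eq_map_poly => x /=; rewrite ratr_int.
rewrite separable_map separable_poly.unlock irreducible_poly_coprime //.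
set q := map_poly _ P.
have q1 : (1 < size q)%N := irrP.1.
have q0 : q != 0 by rewrite -size_poly_gt0 ltnW.
have dq0 : q^`() != 0.
  apply/eqP => /polyP/(_ (size q).-2); rewrite coef_deriv coef0.
  have -> : (size q).-2.+1 = (size q).-1 by case: (size q) q1 => [|[]].
  move/eqP; rewrite mulrn_eq0 -lead_coefE lead_coef_eq0 (negPf q0) orbF.
  by case: (size q) q1 => [|[]].
by apply/negP => /(dvdp_leq dq0); rewrite leqNgt lt_size_deriv.
Qed.

(** * Integrality of the discriminant *)

Lemma integralOver_Aint (x : algC) :
  integralOver (intr : int -> algC) x <-> x \in Aint.
Proof.
split=> [[p pm px]|].
  apply: root_monic_Aint px _ _; first exact: monic_map.
  by apply/polyOverP => i; rewrite coef_map /= intr_int.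
move=> /floorpP[q Dq]; exists q; last by rewrite -Dq root_minCpoly.
have := minCpoly_monic x; rewrite Dq !monicE lead_coef_map_inj //; last exact: intr_inj.
by rewrite -[X in _ == X]/(1%:~R) eqr_int.
Qed.

Lemma Aint_root_monic (g : {poly algC}) (x : algC) :
  g \is monic -> g \is a polyOver Aint -> root g x -> x \in Aint.
Proof.
move=> gm /polyOverP gA gx; apply/integralOver_Aint.
apply: integral_root_monic gm gx _.
by apply/integral_poly => i; apply/integralOver_Aint.
Qed.

(** For [g] of degree [n + 1], multiplying [g(x) = 0] by [a^n] turns it into a monic equation for
    [a x], with coefficients [g_i a^(n-i)]. *)
Lemma Aint_lead_root (g : {poly algC}) (x : algC) :
  g \is a polyOver Aint -> root g x -> lead_coef g * x \in Aint.
Proof.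
move=> /polyOverP gA gx; set a := lead_coef g.
have aA : a \in Aint by exact: gA.
have [[n sg]|g1] : (exists n, size g = n.+2) \/ (size g <= 1)%N.
- by case: (size g) => [|[|n]]; [right|right|left; exists n].
- pose h : {poly algC} := 'X^(n.+1) + \poly_(i < n.+1) (g`_i * a ^+ (n - i)).
  have sh : (size (\poly_(i < n.+1) (g`_i * a ^+ (n - i)))%R < size ('X^(n.+1) : {poly algC}))%N.
    by rewrite size_polyXn ltnS size_poly.
  apply: (@Aint_root_monic h).
  + by rewrite monicE lead_coefDl // lead_coefXn.
  + rewrite rpredD ?rpredX ?polyOverX //; apply/polyOverP => i.
    by rewrite coef_poly; case: ifP => _; rewrite ?rpred0 // rpredM ?rpredX.
  + apply/rootP; have := rootP gx; rewrite horner_coef sg big_ord_recr /=.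
    have -> : g`_n.+1 = a by rewrite /a lead_coefE sg.
    move=> /(congr1 ( *%R (a ^+ n))); rewrite mulr0 => <-.
    rewrite /h hornerD hornerXn horner_poly mulrDr addrC; congr (_ + _).
      rewrite mulr_sumr; apply: eq_bigr => i _; rewrite exprMn.
      have -> : a ^+ n = a ^+ (n - i) * a ^+ i by rewrite -exprD subnK // -ltnS.
      by ring.
    by rewrite exprMn exprS; ring.
- have := rootP gx; rewrite (size1_polyC g1) hornerC => g0.
  by rewrite /a (size1_polyC g1) g0 lead_coefC mul0r rpred0.
Qed.

(** Induction on the size of [h]: removing its leading term [a X^m] changes the product by
    [a X^(m+1) - a x X^m], and [a x] is integral because [x] is a root of the product, whose leading
    coefficient is [a]. *)
Lemma polyOver_Aint_divXsubC (h : {poly algC}) (x : algC) :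
  ('X - x%:P) * h \is a polyOver Aint -> h \is a polyOver Aint.
Proof.
have [n] := ubnP (size h); elim: n h => // n IHn h sh gA.
have [->|h0] := eqVneq h 0; first exact: rpred0.
set g := _ * h in gA; set a := lead_coef h.
have lg : lead_coef g = a by rewrite lead_coefM lead_coefXsubC mul1r.
have aA : a \in Aint by rewrite -lg lead_coefE (polyOverP gA).
have axA : a * x \in Aint.
  by rewrite -lg; apply: Aint_lead_root gA _; rewrite /g rootM root_XsubC eqxx.
set m := (size h).-1; pose h' := h - a *: 'X^m.
have hE : h = h' + a *: 'X^m by rewrite subrK.
have XA k b : b \in Aint -> b *: 'X^k \is a polyOver Aint.
  by move=> bA; rewrite polyOverZ // rpredX // polyOverX.
rewrite hE rpredD ?XA //; apply: IHn.
  have sh0 : size h = m.+1 by rewrite prednK // size_poly_gt0.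
  rewrite -ltnS (leq_trans _ sh) // ltnS sh0 ltnS; apply/leq_sizeP => j.
  rewrite leq_eqVlt coefB coefZ coefXn => /predU1P[<-|mj].
    by rewrite eqxx mulr1 /a lead_coefE subrr.
  by rewrite (gtn_eqF mj) mulr0 subr0 nth_default // sh0.
have -> : ('X - x%:P) * h' = g - a *: 'X^(m.+1) + (a * x) *: 'X^m.
  by rewrite /g hE -!mul_polyC polyCM exprS; ring.
by rewrite rpredD ?rpredB ?XA.
Qed.

(** Dividing out the linear factors of the unselected roots keeps the coefficients integral, and the
    constant term of what remains is the claimed product up to sign. *)
Lemma Aint_lead_prod_roots (I : Type) (r : seq I) (P : pred I) (F : I -> algC)
    (a : algC) :
  a *: \prod_(i <- r) ('X - (F i)%:P) \is a polyOver Aint ->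
  a * \prod_(i <- r | P i) F i \in Aint.
Proof.
have subprod h : h * \prod_(i <- r) ('X - (F i)%:P) \is a polyOver Aint ->
    h * \prod_(i <- r | P i) ('X - (F i)%:P) \is a polyOver Aint.
  elim: r h => [|i r IHr] h; first by rewrite !big_nil.
  rewrite !big_cons; case: ifP => _ hA.
    by rewrite mulrA; apply: IHr; rewrite -mulrA.
  by apply: IHr; apply: (@polyOver_Aint_divXsubC _ (F i)); rewrite mulrCA.
rewrite -mul_polyC => /subprod /polyOverP/(_ 0).
rewrite -horner_coef0 hornerM hornerC horner_prod.
under eq_bigr do rewrite hornerXsubC sub0r.
move=> aA; have [b ->] : exists b : bool, \prod_(i <- r | P i) F i =
    (-1) ^+ b * \prod_(i <- r | P i) - F i.
  elim/big_ind2 : _ => [|u1 u2 v1 v2 [b1 ->] [b2 ->]|i _].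
  - by exists false; rewrite mulr1.
  - by exists (b1 (+) b2); rewrite signr_addb; ring.
  - by exists true; rewrite expr1 mulN1r opprK.
by rewrite mulrCA rpredMsign.
Qed.

(** The discriminant is [a^n det V] squared, with [V] the Vandermonde matrix of the [n + 1] roots.
    Each term of the Leibniz expansion splits into [n] factors, each [a] times a product of
    distinctly indexed roots, hence integral. *)
Lemma Aint_sq_diffs (a : algC) (s : seq algC) :
  a *: \prod_(x <- s) ('X - x%:P) \is a polyOver Aint ->
  a ^+ (2 * size s - 2) * sq_diffs s \in Aint.
Proof.
case: s => [|x s]; first by rewrite /sq_diffs big_ord0 !mulr1 rpred1.
set n := size s; set t := x :: s => tA.
have -> : (2 * size t - 2 = n * 2)%N by rewrite /t /= -/n; lia.
pose V := Vandermonde n.+1 (\row_(i < n.+1) t`_i).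
have -> : sq_diffs t = (\det V) ^+ 2.
  rewrite det_Vandermonde /sq_diffs -prodrXl; apply: eq_bigr => i _.
  by rewrite -prodrXl; apply: eq_bigr => j _; rewrite !mxE -sqrrN opprB.
rewrite exprM -exprMn rpredX // /determinant mulr_sumr rpred_sum // => sigma _.
rewrite mulrCA rpredMsign.
have -> : \prod_i V i (sigma i) = \prod_(i < n.+1) t`_(sigma i) ^+ i.
  by apply: eq_bigr => i _; rewrite !mxE.
(* The power [i] is written as a product over [k < i], and the two products are exchanged: the
   [k]-th factor collects the roots of exponent above [k]. *)
have -> : \prod_(i < n.+1) t`_(sigma i) ^+ i =
    \prod_(k < n) \prod_(i < n.+1 | (k < i)%N) t`_(sigma i).
  rewrite (exchange_big_dep predT) //=; apply: eq_bigr => i _.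
  rewrite -[in LHS](card_ord i) -prodr_const.
  exact: (big_ord_widen n (fun=> t`_(sigma i)) (ltn_ord i)).
have -> : a ^+ n = \prod_(k < n) a by rewrite prodr_const card_ord.
rewrite -big_split /= rpred_prod // => k _.
have -> : \prod_(i < n.+1 | (k < i)%N) t`_(sigma i) =
    \prod_(j < n.+1 | (k < (sigma^-1)%g j)%N) t`_j.
  rewrite [RHS](reindex_inj (@perm_inj _ sigma)) /=.
  by apply: eq_bigl => i; rewrite permK.
apply: Aint_lead_prod_roots; move: tA.
by rewrite (big_nth 0) big_mkord.
Qed.

Lemma horner_char_poly (F : comNzRingType) (n : nat) (A : 'M[F]_n) (y : F) :
  (char_poly A).[y] = \det (y%:M - A).
Proof.
rewrite -/(horner_eval y _) /char_poly -det_map_mx; congr (\det _).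
apply/matrixP => i j; rewrite !mxE /= /horner_eval hornerD hornerN hornerC.
by rewrite hornerMn hornerX.
Qed.

(** After splitting [h] into linear factors, multiplicativity reduces the claim to [det(A - z)],
    which is the characteristic polynomial at [z] up to sign. *)
Lemma det_horner_mx (F : closedFieldType) (n : nat) (A : 'M[F]_n.+1)
    (s : seq F) (h : {poly F}) :
  char_poly A = \prod_(x <- s) ('X - x%:P) ->
  \det (horner_mx A h) = \prod_(x <- s) h.[x].
Proof.
move=> As; have ss : size s = n.+1.
  by have := size_char_poly A; rewrite As size_prod_XsubC => -[].
have [r ->] := closed_field_poly_normal h; set c := lead_coef h.
have -> : \det (horner_mx A (c *: \prod_(z <- r) ('X - z%:P))) =
    c ^+ n.+1 * \prod_(z <- r) \det (A - z%:M).
  rewrite linearZ /= detZ; congr (_ * _); rewrite rmorph_prod /=.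
  rewrite (big_morph _ (@det_mulmx _ n.+1) (det1 _ _)).
  by apply: eq_bigr => z _; rewrite rmorphB /= horner_mx_X horner_mx_C.
under [RHS]eq_bigr do rewrite hornerZ horner_prod.
rewrite big_split /= big_const_seq count_predT iter_mulr_1 ss; congr (_ * _).
rewrite exchange_big /=; apply: eq_bigr => z _.
rewrite -opprB -scaleN1r detZ -horner_char_poly As horner_prod -ss.
elim: (s) => [|x t IHt]; first by rewrite !big_nil mulr1.
by rewrite !big_cons -IHt !hornerXsubC exprS; ring.
Qed.

(** With [A] the companion matrix of [q], the determinant of [q'(A)] is rational and equals the
    product of [q'] over the roots, which is the discriminant up to sign. *)
Lemma Crat_sq_diffs (q : {poly rat}) (s : seq algC) :
  map_poly ratr q = \prod_(x <- s) ('X - x%:P) -> sq_diffs s \in Crat.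
Proof.
case: s => [|x s]; first by rewrite /sq_diffs big_ord0 rpred1.
set t := x :: s => qt.
have qm : q \is monic by rewrite -(map_monic (ratr : rat -> algC)) qt monic_prod_XsubC.
have sq : (size q).-1 = (size s).+1.
  by rewrite -(size_map_poly (ratr : rat -> algC)) qt size_prod_XsubC.
have [A Aq] : exists A : 'M[rat]_((size s).+1), char_poly A = q.
  by rewrite -sq; exists (companionmx q); rewrite companionmxK.
have At : char_poly (map_mx ratr A) = \prod_(x <- t) ('X - x%:P) :> {poly algC}.
  by rewrite -map_char_poly Aq.
have := prod_deriv_roots t; rewrite -qt deriv_map -(det_horner_mx _ At).
rewrite -map_horner_mx det_map_mx; set d := \det _.
have dE : sq_diffs t = (-1) ^+ 'C(size t, 2) * ((-1) ^+ 'C(size t, 2) * sq_diffs t).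
  by rewrite mulrA -exprD addnn -mul2n exprM sqrrN !expr1n mul1r.
by move=> e; rewrite dE -e rpredM ?Crat_rat // rpredX // rpredN rpred1.
Qed.

(** A rational algebraic integer is an integer. *)
Lemma discr_int (P : {poly int}) : P != 0 -> exists D : int, discr P = D%:~R.
Proof.
move=> P0; have l0 : (lead_coef P)%:~R != 0 :> algC by rewrite intr_eq0 lead_coef_eq0.
suff : discr P \in Num.int by move=> /intrP[D ->]; exists D.
rewrite discrE //; apply: Cint_rat_Aint.
  rewrite rpredM ?rpredX ?rpred_int //.
  apply: (@Crat_sq_diffs ((lead_coef P)%:~R^-1 *: map_poly intr P)).
  rewrite -[RHS](scalerK l0) -crootsP // map_polyZ /= fmorphV /= ratr_int.
  by rewrite -map_poly_comp; congr (_ *: _); apply: eq_map_poly => z /=; rewrite ratr_int.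
rewrite -size_croots //; apply: Aint_sq_diffs; rewrite -crootsP //.
by apply/polyOverP => i; rewrite coef_map Aint_int.
Qed.

(** * Binary forms in two linear polynomials *)

(** [P] and [G] have the same leading coefficient, and the roots of [G] are [(x - a) / b] for the
    roots [x] of [P]; each of the [n(n-1)/2] squared differences contributes [b^2]. *)
Lemma discr_affine (P G : {poly int}) (a b : int) (n : nat) :
  size P = n.+1 -> b != 0 -> P \Po (a%:P + b *: 'X) = b ^+ n *: G ->
  discr P = (b ^+ (n * n.-1))%:~R * discr G.
Proof.
move=> sP b0 PG.
have P0 : P != 0 by rewrite -size_poly_gt0 sP.
have sl : size (a%:P + b *: 'X) = 2.
  by rewrite addrC size_addl ?size_scale ?size_polyX // ltnS size_polyC_leq1.
have sG : size G = n.+1.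
  by rewrite -sP -(size_comp_poly2 P sl) PG size_scale // expf_neq0.
have G0 : G != 0 by rewrite -size_poly_gt0 sG.
have lG : lead_coef G = lead_coef P.
  apply: (mulfI (expf_neq0 n b0)); rewrite -lead_coefZ -PG lead_coef_comp ?sl //.
  rewrite sP mulrC addrC lead_coefDl ?lead_coefZ ?lead_coefX ?mulr1 //.
  by rewrite size_scale // size_polyX ltnS size_polyC_leq1.
pose aC : algC := a%:~R; pose bC : algC := b%:~R.
have bC0 : bC != 0 by rewrite intr_eq0.
have lP0 : (lead_coef P)%:~R != 0 :> algC by rewrite intr_eq0 lead_coef_eq0.
have rootsG : perm_eq (croots G) [seq - aC / bC + bC^-1 * x | x <- croots P].
  apply: prod_XsubC_eq; apply: (scalerI lP0); rewrite -{1}lG -crootsP //.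
  apply: (scalerI (expf_neq0 n bC0)).
  have -> : bC ^+ n *: map_poly intr G = map_poly intr P \Po (aC%:P + bC *: 'X).
    have := congr1 (map_poly (intr : int -> algC)) PG.
    rewrite map_comp_poly rmorphD /= map_polyC !map_polyZ /= map_polyX => ->.
    by rewrite rmorphXn.
  rewrite crootsP // comp_polyZ rmorph_prod /= big_map scalerA mulrC -scalerA.
  congr (_ *: _); have -> : n = size (croots P) by rewrite size_croots ?sP.
  elim: (croots P) => [|x s IHs]; first by rewrite !big_nil scale1r.
  rewrite !big_cons exprS -scalerA scalerAr IHs scalerAl; congr (_ * _).
  rewrite comp_polyB comp_polyX comp_polyC scalerBr scale_polyC.
  have -> : bC * (- aC / bC + bC^-1 * x) = x - aC by field.
  by rewrite polyCB; ring.
rewrite !discrE // sP sG lG (sq_diffs_perm rootsG) sq_diffs_affine size_croots // sP.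
rewrite /= mulrCA; congr (_ * _); rewrite mulrA rmorphXn /= -/bC -exprMn.
by rewrite mulfV // expr1n mul1r.
Qed.

Lemma irreducible_affine (F : fieldType) (P G : {poly F}) (a b c : F) :
  b != 0 -> c != 0 -> P \Po (a%:P + b *: 'X) = c *: G ->
  irreducible_poly G -> irreducible_poly P.
Proof.
move=> b0 c0 PG [sG irrG].
have sl : size (a%:P + b *: 'X) = 2.
  by rewrite addrC size_addl ?size_scale ?size_polyX // ltnS size_polyC_leq1.
have sP : size P = size G by rewrite -(size_comp_poly2 P sl) PG size_scale.
split; first by rewrite sP.
move=> q q1 qP; rewrite -dvdp_size_eqp //.
have := dvdp_comp_poly (a%:P + b *: 'X) qP; rewrite PG dvdpZr //.
move=> /irrG; rewrite size_comp_poly2 // => /(_ q1) /eqp_size.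
by rewrite size_comp_poly2 // => ->; rewrite sP.
Qed.

Definition binform (n : nat) (b : nat -> int) (L1 L2 : {poly int}) : {poly int} :=
  \sum_(i < n.+1) b i *: (L1 ^+ i * L2 ^+ (n - i)).

Lemma comp_binform (n : nat) (b : nat -> int) (L1 L2 M : {poly int}) :
  binform n b L1 L2 \Po M = binform n b (L1 \Po M) (L2 \Po M).
Proof.
rewrite /binform raddf_sum /=; apply: eq_bigr => i _.
by rewrite comp_polyZ comp_polyM !rmorphXn.
Qed.

Lemma binformZ (n : nat) (b : nat -> int) (L1 L2 : {poly int}) (d : int) :
  binform n b (d *: L1) (d *: L2) = d ^+ n *: binform n b L1 L2.
Proof.
rewrite /binform scaler_sumr; apply: eq_bigr => i _.
have -> : d ^+ n = d ^+ i * d ^+ (n - i) by rewrite -exprD subnKC // -ltnS.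
by rewrite !exprZn -scalerAl -scalerAr !scalerA; congr (_ *: _); ring.
Qed.

Lemma horner_binform (n : nat) (b : nat -> int) (L1 L2 : {poly int}) (x : int) :
  (binform n b L1 L2).[x] =
    \sum_(i < n.+1) b i * (L1.[x] ^+ i * L2.[x] ^+ (n - i)).
Proof.
rewrite /binform horner_sum; apply: eq_bigr => i _.
by rewrite hornerZ hornerM !horner_exp.
Qed.

Lemma size_linear_le (v u : int) : (size (v *: 'X + u%:P)%R <= 2)%N.
Proof.
rewrite (leq_trans (size_polyD _ _)) // geq_max (leq_trans (size_scale_leq _ _)) ?size_polyX //.
by rewrite (leq_trans (size_polyC_leq1 _)).
Qed.

Lemma size_binform_le (n : nat) (b : nat -> int) (L1 L2 : {poly int}) :
  (size L1 <= 2)%N -> (size L2 <= 2)%N -> (size (binform n b L1 L2) <= n.+1)%N.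
Proof.
have pow (L : {poly int}) k : (size L <= 2)%N -> (size (L ^+ k) <= k.+1)%N.
  move=> sL; apply: (leq_trans (size_poly_exp_leq _ _)); rewrite ltnS.
  by case: (size L) sL => [|[|[|]]] //= _; rewrite ?mul0n ?mul1n.
move=> s1 s2; apply: (leq_trans (size_sum _ _ _)); apply/bigmax_leqP => i _.
apply: (leq_trans (size_scale_leq _ _)); apply: (leq_trans (size_polyMleq _ _)).
have := pow L1 i s1; have := pow L2 (n - i)%N s2; have := ltn_ord i; lia.
Qed.

(** Modulo [p] only the top term survives, and there the first linear form reduces to [v X]. *)
Lemma binform_mod_prime (n p : nat) (b : nat -> int) (v g h2 : int)
    (L2 : {poly int}) :
  (forall i, (i < n)%N -> (p %| b i)%Z) ->
  exists H, binform n b (v *: 'X + (p%:Z * g)%:P) L2 =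
    (b n * v ^+ n) *: 'X^n + p%:Z *: H.
Proof.
move=> pb.
have pow k : exists C, (v *: 'X + (p%:Z * g)%:P) ^+ k = (v *: 'X) ^+ k + p%:Z *: C.
  elim: k => [|k [C IHk]]; first by exists 0; rewrite scaler0 addr0.
  exists (C * (v *: 'X + (p%:Z * g)%:P) + (v *: 'X) ^+ k * g%:P).
  by rewrite exprSr IHk exprSr -!mul_polyC polyCM; ring.
have [C topE] := pow n.
have [H HE] : exists H, \sum_(i < n)
   b i *: ((v *: 'X + (p%:Z * g)%:P) ^+ i * L2 ^+ (n - i)) = p%:Z *: H.
  apply: (big_ind (fun A => exists H, A = p%:Z *: H)).
  - by exists 0; rewrite scaler0.
  - by move=> _ _ [A ->] [B ->]; exists (A + B); rewrite scalerDr.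
  - move=> i _; have /dvdzP[c ->] := pb i (ltn_ord i).
    by rewrite mulrC -scalerA; eexists.
exists (b n *: C + H); rewrite /binform big_ord_recr /= HE subnn expr0 mulr1 topE.
by rewrite exprZn -!mul_polyC !polyCM; ring.
Qed.

Lemma Euclid_dvdzM (p : nat) (x y : int) : prime p ->
  (p %| x * y)%Z = (p %| x)%Z || (p %| y)%Z.
Proof. by move=> pp; rewrite !dvdzE /= abszM Euclid_dvdM. Qed.

Lemma Euclid_dvdzX (p n : nat) (x : int) : prime p ->
  (p %| x ^+ n)%Z -> (p %| x)%Z.
Proof. by move=> pp; rewrite !dvdzE /= abszX Euclid_dvdX // => /andP[]. Qed.

Lemma prime_coprimez (p : nat) (x : int) : prime p ->
  coprimez p x = ~~ (p %| x)%Z.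
Proof. by move=> pp; rewrite coprimezE dvdzE prime_coprime. Qed.

Lemma binform_eisenstein (n p : nat) (b : nat -> int) (v v2 g1 g2 : int) :
  (1 < n)%N -> prime p -> ~~ (p %| v)%Z ->
  (p %| g1)%Z -> ~~ (p %| g2)%Z ->
  (forall i, (i < n)%N -> (p %| b i)%Z) -> ~~ (p %| b n)%Z ->
  ~~ ((p ^ 2)%N %| b 0%N)%Z ->
  let G := binform n b (v *: 'X + g1%:P) (v2 *: 'X + g2%:P) in
  size G = n.+1 /\ irreducible_poly (map_poly intr G : {poly rat}).
Proof.
move=> n1 pp pv /dvdzP[g g1E] pg2 pb pbn pb0 G.
have [H GE] : exists H, G = (b n * v ^+ n) *: 'X^n + p%:Z *: H.
  by rewrite /G g1E [g * _]mulrC; exact: binform_mod_prime.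
have Gn : ~~ (p %| G`_n)%Z.
  rewrite GE coefD !coefZ coefXn eqxx mulr1 rpredDr; last exact: dvdz_mulr.
  by rewrite Euclid_dvdzM // negb_or pbn; apply: contra pv; exact: Euclid_dvdzX.
have sG : size G = n.+1.
  apply/eqP; rewrite eqn_leq size_binform_le ?size_linear_le //=.
  by rewrite ltnNge; apply: contra Gn => ?; rewrite nth_default ?dvdz0.
split=> //; apply/irreducible_rat_int; apply: (eisenstein_crit pp); rewrite ?sG ?lead_coefE ?sG //.
- by case: (n) n1.
- have lin0 (c g' : int) : (c *: 'X + g'%:P).[0] = g' by rewrite !hornerE.
  rewrite -horner_coef0 horner_binform !lin0 big_ord_recl /= expr0 subn0 mul1r.
  rewrite rpredDr.
    rewrite mulrC Gauss_dvdzr // coprimezXr //.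
    have : coprimez p g2 by rewrite prime_coprimez.
    by rewrite !coprimezE => /(coprimeXl 2).
  apply: rpred_sum => i _; rewrite /bump /= add1n g1E.
  (* Modulo [p^2] the constant term is [b_0 g2^n]: the term of index 1 has a factor [p] from [b_1]
     (as [1 < n]) and one from [g1], and the later terms contain [g1^2]. *)
  have [i0|i0] := eqVneq (i : nat) 0%N.
    rewrite i0 expr1; have /dvdzP[c ->] := pb 1%N n1.
    by apply/dvdzP; exists (c * g * g2 ^+ (n - 1)); ring.
  have -> : i.+1 = (2 + i.-1)%N by case: (i : nat) i0.
  by apply/dvdzP; exists (b (2 + i.-1)%N * g ^+ 2 * (g * p) ^+ i.-1 * g2 ^+ (n - (2 + i.-1))); rewrite exprD; ring.
- move=> i /= iltn; rewrite GE coefD !coefZ coefXn (ltn_eqF iltn) mulr0 add0r.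
  by rewrite dvdz_mulr.
Qed.

(** Substituting [a + d X] with [d = p^k] makes both linear forms divisible by [d]. The quotient
    forms have determinant 1 and give an Eisenstein polynomial [G]; irreducibility passes from [G]
    to [P], and the discriminant gains [d^(n(n-1))]. *)
Lemma binform_clustered (n p k : nat) (b : nat -> int) (u v u2 v2 : int) :
  (1 < n)%N -> prime p -> ~~ (p %| v)%Z -> v * u2 - v2 * u = p%:Z ^+ k ->
  (forall i, (i < n)%N -> (p %| b i)%Z) -> ~~ (p %| b n)%Z ->
  ~~ ((p ^ 2)%N %| b 0%N)%Z ->
  let P := binform n b (v *: 'X + u%:P) (v2 *: 'X + u2%:P) in
  [/\ size P = n.+1, irreducible_poly (map_poly intr P : {poly rat}) &
    exists2 D : int, D%:~R = discr P &
      D != 0 /\ ((p ^ (k * (n * n.-1)))%N %| D)%Z].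
Proof.
move=> n1 pp pv uv pb pbn pb0 P.
(* The root of [v X + u] is approximated modulo [p^(k+1)], one power beyond [d], so that [g1]
   remains divisible by [p] after division by [d]. *)
have cop : coprimez v (p%:Z ^+ k.+1).
  by rewrite coprimezXr // coprimez_sym prime_coprimez.
have [[x y] /= xy] := coprimezP _ _ cop.
set d := p%:Z ^+ k; pose a := - u * x; pose g1 := u * y * p%:Z.
have d0 : d != 0 by rewrite expf_neq0 // -lt0n prime_gt0.
have E1 : v * a + u = d * g1.
  have uE : u = u * x * v + u * y * p%:Z * d.
    by rewrite -[LHS]mulr1 -xy exprS -/d; ring.
  by rewrite /a /g1 [X in _ + X]uE; ring.
have [g2 E2] : exists g2, v2 * a + u2 = d * g2.
  have : (d %| v2 * a + u2)%Z.
    have copd : coprimez d v by rewrite coprimezXl // prime_coprimez.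
    rewrite -(Gauss_dvdzr _ copd); apply/dvdzP; exists (v2 * g1 + 1).
    have -> : v * (v2 * a + u2) = v2 * (v * a + u) + (v * u2 - v2 * u) by ring.
    by rewrite E1 uv -/d; ring.
  by case/dvdzP=> g2 ->; exists g2; rewrite mulrC.
have pg1 : (p %| g1)%Z by rewrite dvdz_mull.
have E3 : v * g2 - v2 * g1 = 1.
  apply: (mulfI d0); rewrite mulr1 -{2}/d -[RHS]uv.
  have -> : d * (v * g2 - v2 * g1) = v * (d * g2) - v2 * (d * g1) by ring.
  by rewrite -E1 -E2; ring.
(* The determinant is 1 and [p] divides [g1], so [p] cannot divide [g2]. *)
have pg2 : ~~ (p %| g2)%Z.
  apply/negP => pg2; have : (p %| (1 : int)%R)%Z by rewrite -E3 rpredB // dvdz_mull.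
  by rewrite dvdz1 /= => /eqP p1; move: pp; rewrite p1.
have [sG irrG] := binform_eisenstein v2 n1 pp pv pg1 pg2 pb pbn pb0.
set G := binform _ _ _ _ in sG irrG.
have PG : P \Po (a%:P + d *: 'X) = d ^+ n *: G.
  rewrite comp_binform -binformZ; congr binform.
  - rewrite comp_polyD comp_polyZ comp_polyX comp_polyC scalerDr.
    by rewrite scalerA -!mul_polyC -[u]addr0 -{1}(addKr (v * a) u) E1 !(polyCD, polyCM, polyCN); ring.
  - rewrite comp_polyD comp_polyZ comp_polyX comp_polyC scalerDr.
    by rewrite -{1}(addKr (v2 * a) u2) E2 -!mul_polyC !(polyCD, polyCM, polyCN); ring.
have sl : size (a%:P + d *: 'X) = 2.
  by rewrite addrC size_addl ?size_scale ?size_polyX // ltnS size_polyC_leq1.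
have sP : size P = n.+1.
  by rewrite -(size_comp_poly2 P sl) PG size_scale // expf_neq0.
have irrP : irreducible_poly (map_poly intr P : {poly rat}).
  apply: (@irreducible_affine _ _ _ a%:~R d%:~R (d ^+ n)%:~R _ _ _ irrG).
  - by rewrite intr_eq0.
  - by rewrite intr_eq0 expf_neq0.
  - have := congr1 (map_poly (intr : int -> rat)) PG.
    by rewrite map_comp_poly rmorphD /= map_polyC !map_polyZ /= map_polyX.
have G0 : G != 0 by rewrite -size_poly_gt0 sG.
have [DG DGE] := discr_int G0.
have DP := discr_affine sP d0 PG.
split=> //; exists (d ^+ (n * n.-1) * DG); first by rewrite DP DGE -rmorphM.
split; last by rewrite dvdzE /= abszM /d -exprM abszX dvdn_mulr.
by rewrite -(intr_eq0 algC) rmorphM /= -DGE -DP discr_neq0.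
Qed.

(** * Separation of the discs and injectivity *)

Lemma exists_approx_root (p k : nat) (u v : int) :
  prime p -> ~~ (p %| v)%Z -> exists a : int, (p%:Z ^+ k %| v * a + u)%Z.
Proof.
move=> pp pv; have cop : coprimez v (p%:Z ^+ k).
  by rewrite coprimezXr // coprimez_sym prime_coprimez.
have [[x y] /= xy] := coprimezP _ _ cop.
exists (- u * x); apply/dvdzP; exists (u * y).
have uE : u = u * x * v + u * y * p%:Z ^+ k by rewrite -[LHS]mulr1 -xy; ring.
by rewrite [X in _ + X]uE; ring.
Qed.

(** Multiplied by [v], a unit modulo [p], the second form at [a] becomes [v2 (v a + u) + d]. *)
Lemma dvdz_companion_row (p k : nat) (u v u2 v2 a d : int) :
  prime p -> ~~ (p %| v)%Z -> v * u2 - v2 * u = d -> (p%:Z ^+ k %| d)%Z ->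
  (p%:Z ^+ k %| v * a + u)%Z -> (p%:Z ^+ k %| v2 * a + u2)%Z.
Proof.
move=> pp pv uv kd kX.
have cop : coprimez (p%:Z ^+ k) v by rewrite coprimezXl // prime_coprimez.
rewrite -(Gauss_dvdzr _ cop).
have -> : v * (v2 * a + u2) = v2 * (v * a + u) + (v * u2 - v2 * u) by ring.
by rewrite uv rpredD // dvdz_mull.
Qed.

(** Every term has total degree [n] in two multiples of [p^k]. Together with its converse below,
    this reads the disc off from the values of the polynomial. *)
Lemma dvdz_binform_approx_root (n p k : nat) (b : nat -> int)
    (u v u2 v2 a : int) :
  prime p -> ~~ (p %| v)%Z -> v * u2 - v2 * u = p%:Z ^+ k ->
  (p%:Z ^+ k %| v * a + u)%Z ->
  (p%:Z ^+ (k * n) %| (binform n b (v *: 'X + u%:P) (v2 *: 'X + u2%:P)).[a])%Z.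
Proof.
move=> pp pv uv kX; have kY := dvdz_companion_row pp pv uv (dvdzz _) kX.
rewrite horner_binform !hornerE; apply: rpred_sum => i _.
rewrite dvdz_mull //.
have -> : (k * n = k * i + k * (n - i))%N by rewrite -mulnDr subnKC // -ltnS.
rewrite exprD !exprM; apply: dvdz_mul; exact: dvdz_exp2r.
Qed.

(* If p^j is the exact power of p dividing va + u and j < k, then p^j also
   divides v2 a + u2, so the top term b_n (va + u)^n is the only one of
   valuation jn and P(a) has valuation jn < kn. *)
Lemma approx_root_of_dvdz_binform (n p k : nat) (b : nat -> int)
    (u v u2 v2 a : int) :
  (0 < n)%N -> prime p -> ~~ (p %| v)%Z -> v * u2 - v2 * u = p%:Z ^+ k ->
  (forall i, (i < n)%N -> (p %| b i)%Z) -> ~~ (p %| b n)%Z ->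
  (p%:Z ^+ (k * n) %| (binform n b (v *: 'X + u%:P) (v2 *: 'X + u2%:P)).[a])%Z ->
  (p%:Z ^+ k %| v * a + u)%Z.
Proof.
move=> n0 pp pv uv pb pbn; rewrite horner_binform => kP.
have -> : v * a + u = (v *: 'X + u%:P).[a] by rewrite !hornerE.
set X := (v *: 'X + u%:P).[a] in kP *; set Y := (v2 *: 'X + u2%:P).[a] in kP.
have XE : X = v * a + u by rewrite /X !hornerE.
have YE : Y = v2 * a + u2 by rewrite /Y !hornerE.
apply: contraT => kX.
have X0 : (0 < `|X|)%N by rewrite absz_gt0; apply: contraNneq kX => ->; exact: dvdz0.
set j := logn p `|X|.
have jk : (j < k)%N.
  by rewrite ltnNge -pfactor_dvdn //; apply: contra kX; rewrite dvdzE abszX.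
have [X' X'E] : exists X', X = X' * p%:Z ^+ j.
  by apply/dvdzP; rewrite dvdzE abszX /= pfactor_dvdnn.
have pX' : ~~ (p %| X')%Z.
  apply/negP => /dvdzP[c cE]; suff : (p ^ j.+1 %| `|X|)%N by rewrite pfactor_dvdn // ltnn.
  by rewrite X'E cE -mulrA -exprS abszM abszX dvdn_mull.
have jd : (p%:Z ^+ j %| p%:Z ^+ k)%Z by rewrite dvdz_exp2l // ltnW.
have [Y' Y'E] : exists Y', Y = Y' * p%:Z ^+ j.
  apply/dvdzP; rewrite YE; apply: (dvdz_companion_row pp pv uv jd).
  by rewrite -XE X'E dvdz_mull.
have sumE : \sum_(i < n.+1) b i * (X ^+ i * Y ^+ (n - i)) =
    p%:Z ^+ (j * n) * \sum_(i < n.+1) b i * (X' ^+ i * Y' ^+ (n - i)).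
  rewrite mulr_sumr; apply: eq_bigr => i _.
  have -> : (j * n = j * i + j * (n - i))%N by rewrite -mulnDr subnKC // -ltnS.
  by rewrite X'E Y'E !exprMn exprD !exprM; ring.
have : (p %| \sum_(i < n.+1) b i * (X' ^+ i * Y' ^+ (n - i)))%Z.
  have pj0 : p%:Z ^+ (j * n) != 0 by rewrite expf_neq0 // -lt0n prime_gt0.
  rewrite -(@dvdz_mul2l (p%:Z ^+ (j * n))) // -sumE; apply: dvdz_trans kP.
  by rewrite -exprSr dvdz_exp2l // ltn_pmul2r.
rewrite big_ord_recr /= subnn expr0 mulr1 rpredDl; last first.
  by apply: rpred_sum => i _; rewrite dvdz_mulr // pb.
rewrite Euclid_dvdzM // (negPf pbn) /= => /(Euclid_dvdzX pp).
by rewrite (negPf pX').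
Qed.

(** Evaluation at the root [x] of [L1] isolates the coefficient of index 0; then [L1] is cancelled
    and induction applies. *)
Lemma binform_free (F : fieldType) (L1 L2 : {poly F}) (x : F) (n : nat)
    (c : nat -> F) :
  L1 != 0 -> L1.[x] = 0 -> L2.[x] != 0 ->
  \sum_(i < n.+1) c i *: (L1 ^+ i * L2 ^+ (n - i)) = 0 ->
  forall i, (i <= n)%N -> c i = 0.
Proof.
move=> L10 L1x L2x; elim: n c => [|n IHn] c.
  rewrite big_ord_recl big_ord0 addr0 mul1r -mul_polyC mulr1 => /eqP.
  by rewrite polyC_eq0 => /eqP c0 i; rewrite leqn0 => /eqP ->.
rewrite big_ord_recl /= expr0 mul1r subn0.
under eq_bigr do rewrite /bump /= add1n exprS subSS -mulrA scalerAr.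
rewrite -mulr_sumr => sum0.
have c0 : c 0%N = 0.
  have := congr1 (horner^~ x) sum0.
  rewrite hornerD hornerM L1x mul0r addr0 hornerZ horner_exp horner0 => /eqP.
  by rewrite mulf_eq0 expf_eq0 (negPf L2x) andbF orbF => /eqP.
move: sum0; rewrite c0 scale0r add0r => /eqP; rewrite mulf_eq0 (negPf L10) /=.
by move=> /eqP /(IHn (fun i => c i.+1)) cS [|i] //; exact: cS.
Qed.

Lemma binform_inj (n : nat) (b b' : nat -> int) (u v u2 v2 : int) :
  v != 0 -> v * u2 - v2 * u != 0 ->
  binform n b (v *: 'X + u%:P) (v2 *: 'X + u2%:P) =
    binform n b' (v *: 'X + u%:P) (v2 *: 'X + u2%:P) ->
  forall i, (i <= n)%N -> b i = b' i.
Proof.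
move=> v0 uv bb' i lein.
pose L (v u : int) : {poly rat} := v%:~R *: 'X + (u%:~R)%:P.
have Lmap v' u' : map_poly intr (v' *: 'X + u'%:P) = L v' u'.
  by rewrite rmorphD /= map_polyZ /= map_polyX map_polyC.
have v0' : v%:~R != 0 :> rat by rewrite intr_eq0.
suff : (b i - b' i)%:~R = 0 :> rat by move/eqP; rewrite intr_eq0 subr_eq0 => /eqP.
apply: (@binform_free _ (L v u) (L v2 u2) (- u%:~R / v%:~R) n
  (fun i => (b i - b' i)%:~R)) lein.
- rewrite -size_poly_gt0 /L size_addl ?size_scale ?size_polyX //.
  by rewrite ltnS size_polyC_leq1.
- by rewrite /L hornerD hornerZ hornerX hornerC; field.
- rewrite /L hornerD hornerZ hornerX hornerC.
  have -> : v2%:~R * (- u%:~R / v%:~R) + u2%:~R =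
      (v * u2 - v2 * u)%:~R / v%:~R :> rat by rewrite rmorphB !rmorphM /=; field.
  by rewrite mulf_neq0 ?invr_eq0 // intr_eq0.
- move/(congr1 (map_poly (intr : int -> rat))): bb' => /eqP.
  rewrite -subr_eq0 /binform !rmorph_sum /= -sumrB => /eqP; apply: etrans.
  apply: eq_bigr => j _; rewrite !map_polyZ /= -scalerBl -rmorphB /=.
  by rewrite rmorphM !rmorphXn /= !Lmap.
Qed.

(** * Counting coprime pairs *)

(** The least [v2] for which [v u2 - v2 u = d] has an integer solution [u2]. Taking it below [v]
    keeps the second linear form small; the default [v] of [find] does not occur for coprime [u] and
    [v > 0]. *)
Definition companion_entry (d u v : nat) : nat :=
  find (fun w => (v %| w * u + d)%N) (iota 0 v).

Lemma companion_entryP (d u v : nat) : coprime u v -> (0 < v)%N ->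
  (companion_entry d u v < v)%N /\ (v %| companion_entry d u v * u + d)%N.
Proof.
move=> cop v0; rewrite /companion_entry; set a := fun w => _.
have hasa : has a (iota 0 v).
  have copz : coprimez u v by rewrite coprimezE.
  have [[x y] /= xy] := coprimezP _ _ copz.
  (* Here [x] inverts [u] modulo [v], so [w] solves [w u + d = 0] modulo [v]. *)
  pose w := (- (d%:Z * x) %% v)%Z.
  have w0 : 0 <= w by rewrite modz_ge0 // -lt0n.
  have wv : w < v by rewrite ltz_pmod.
  have wE : `|w|%N = w :> int by rewrite gez0_abs.
  apply/hasP; exists `|w|%N; first by rewrite mem_iota /= add0n -ltz_nat wE.
  rewrite /a; suff : (v %| w * u + d)%Z by rewrite -wE dvdzE.
  have -> : w = - (d%:Z * x) - (- (d%:Z * x) %/ v)%Z * v.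
    have e := divz_eq (- (d%:Z * x)) v.
    by rewrite [X in _ = X - _]e addrAC subrr add0r.
  apply/dvdzP; exists (y * d%:Z - (- (d%:Z * x) %/ v)%Z * u).
  have dE : d%:Z = d%:Z * x * u + d%:Z * y * v by rewrite -[LHS]mulr1 -xy; ring.
  by rewrite [X in _ + X]dE; ring.
move: (hasa); rewrite has_find size_iota => fv; split=> //.
by have := nth_find 0%N hasa; rewrite nth_iota.
Qed.

Lemma card_multiples (t d : nat) :
  #|[set i : 'I_t | (d %| i.+1)%N]| = (t %/ d)%N.
Proof.
rewrite divn_count_dvd big_add1 big_mkord -sum1_card big_mkcond /=.
by apply: eq_bigr => i _; rewrite inE; case: (d %| i.+1)%N.
Qed.

(** Telescoping with [1/(x+1)^2 <= 1/x - 1/(x+1)], exact at the first term [1/4]. The resulting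
    bound [3/4] is below 1, which leaves a positive proportion of coprime pairs. *)
Lemma sum_inv_sqr_le (F : realFieldType) (m : nat) :
  \sum_(2 <= d < m.+3) (d%:R ^- 2 : F) <= 3 / 4 - m.+2%:R^-1.
Proof.
elim: m => [|m IHm]; first by rewrite big_nat1 expr2 invfM; lra.
rewrite big_nat_recr //= (le_trans (lerD IHm (lexx _))) //.
rewrite -subr_ge0.
have m0 : 0 < m.+2%:R :> F by rewrite ltr0n.
rewrite -[m.+3%:R]natr1; move: m.+2%:R m0 => x x0.
have -> : 3 / 4 - (x + 1)^-1 - (3 / 4 - x^-1 + (x + 1) ^- 2) =
    (x * (x + 1) ^+ 2)^-1.
  by field; rewrite !gt_eqF // addr_gt0.
by rewrite invr_ge0 mulr_ge0 ?exprn_ge0 ?addr_ge0 // ltW.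
Qed.

Lemma sum_divn_sqr_le (t : nat) :
  (4 * \sum_(2 <= d < t.+1) (t %/ d) ^ 2 <= 3 * t ^ 2)%N.
Proof.
case: t => [|[|m]]; [by rewrite big_geq|by rewrite big_geq|set t := m.+2].
rewrite -(ler_nat rat) (natrM _ 4) (natrM _ 3) natr_sum (natrX _ t).
have le1 : \sum_(2 <= d < t.+1) ((t %/ d) ^ 2)%:R <=
    t%:R ^+ 2 * \sum_(2 <= d < t.+1) (d%:R ^- 2 : rat).
  rewrite mulr_sumr; apply: ler_sum_nat => d /andP[d2 _].
  rewrite natrX -exprVn -exprMn lerXn2r ?nnegrE ?divr_ge0 //.
  by rewrite ler_pdivlMr ?ltr0n 1?ltnW // -natrM ler_nat leq_trunc_div.
have le2 : \sum_(2 <= d < t.+1) (d%:R ^- 2 : rat) <= 3 / 4.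
  by apply: le_trans (sum_inv_sqr_le _ m) _; rewrite gerBl invr_ge0.
have t0 : 0 <= t%:R ^+ 2 :> rat by rewrite exprn_ge0.
have := ler_wpM2l t0 le2; lra.
Qed.

(** Union bound: a non-coprime pair consists of two multiples of its gcd [d >= 2], and [(t / d)^2]
    pairs are of that kind. The ordinal [i] stands for the integer [i + 1]. *)
Lemma card_coprime_pairs (t : nat) :
  (t ^ 2 <= 4 * #|[set w : 'I_t * 'I_t | coprime w.1.+1 w.2.+1]|)%N.
Proof.
set C := [set w | _]; pose M d := [set i : 'I_t | (d %| i.+1)%N].
have covC : ~: C \subset \bigcup_(d < t.+1 | (2 <= d)%N) finset.setX (M d) (M d).
  apply/fintype.subsetP => -[x y]; rewrite !inE /= => ncop.
  have g0 : (0 < gcdn x.+1 y.+1)%N by rewrite gcdn_gt0.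
  have gt : (gcdn x.+1 y.+1 < t.+1)%N.
    by rewrite ltnS (leq_trans _ (ltn_ord x)) // dvdn_leq // dvdn_gcdl.
  apply/finset.bigcupP; exists (Ordinal gt) => /=.
    by move: ncop g0; rewrite /coprime; case: gcdn => [|[|]].
  by rewrite !inE /= dvdn_gcdl dvdn_gcdr.
have cC : (#|~: C| <= \sum_(2 <= d < t.+1) (t %/ d) ^ 2)%N.
  apply: leq_trans (subset_leq_card covC) _.
  have leU (I : finType) (P : pred I) (F : I -> {set 'I_t * 'I_t}) :
      (#|\bigcup_(i | P i) F i| <= \sum_(i | P i) #|F i|)%N.
    elim/big_rec2: _ => [|i k A _ IH]; first by rewrite cards0.
    by rewrite (leq_trans (leq_card_setU _ _)) // leq_add2l.
  apply: leq_trans (leU _ _ _) _.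
  rewrite (eq_bigr (fun d : 'I_t.+1 => (t %/ d) ^ 2)%N) => [|d _]; last first.
    by rewrite cardsX !card_multiples expnS expn1.
  rewrite -(big_mkord (fun d => 2 <= d)%N (fun d => (t %/ d) ^ 2)%N).
  by rewrite (big_nat_widenl 2 0) //= leqnn.
have := cardsC C; rewrite card_prod card_ord.
have := sum_divn_sqr_le t; move: cC; rewrite !expnS expn0 muln1.
set S := \sum_(_ <= _ < _) _; lia.
Qed.

(** The pairs [(u, v)], each entry shifted down by one. The lower bound on [v] serves both height
    estimates. *)
Definition good_pairs (p t : nat) : {set 'I_t * 'I_t} :=
  [set w : 'I_t * 'I_t |
    [&& coprime w.1.+1 w.2.+1, ~~ (p %| w.2.+1)%N & (t <= 16 * w.2.+1)%N]].

(** A prime cannot divide both entries of a coprime pair, so by swapping entries at least half of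
    the [t^2/4] coprime pairs have [v] prime to [p]. At most [t^2/16] pairs have [16 v < t], and
    [1/8 - 1/16 = 1/16]. *)
Lemma card_good_pairs (p t : nat) : prime p ->
  (t ^ 2 <= 16 * #|good_pairs p t|)%N.
Proof.
move=> pp; set C := [set w : 'I_t * 'I_t | coprime w.1.+1 w.2.+1].
pose B := [set w : 'I_t * 'I_t | coprime w.1.+1 w.2.+1 && ~~ (p %| w.2.+1)%N].
pose small := [set i : 'I_t | (16 * i.+1 < t)%N].
have CB : (#|C| <= 2 * #|B|)%N.
  pose sw (w : 'I_t * 'I_t) := (w.2, w.1).
  have swi : injective sw by move=> [? ?] [? ?] [-> ->].
  have sub : C \subset B :|: sw @: B.
    apply/fintype.subsetP => -[x y]; rewrite !inE /= => cop.
    have [py|_] := boolP (p %| y.+1)%N; last by rewrite cop.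
    rewrite cop /=; apply/imsetP; exists (y, x) => //.
    rewrite inE /= coprime_sym cop /=; apply/negP => px.
    have : (p %| gcdn x.+1 y.+1)%N by rewrite dvdn_gcd px py.
    by rewrite (eqP cop) dvdn1 => /eqP p1; move: pp; rewrite p1.
  apply: leq_trans (subset_leq_card sub) _; apply: leq_trans (leq_card_setU _ _) _.
  by rewrite card_imset // mul2n addnn.
have BG : (#|B| <= #|good_pairs p t| + t * #|small|)%N.
  have sub : B \subset good_pairs p t :|: finset.setX finset.setT small.
    apply/fintype.subsetP => -[x y]; rewrite !inE /= => /andP[-> ->] /=.
    by case: leqP.
  apply: leq_trans (subset_leq_card sub) _; apply: leq_trans (leq_card_setU _ _) _.
  by rewrite cardsX cardsT card_ord.
have cs : (16 * #|small| <= t)%N.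
  have : (#|small| <= t %/ 16)%N.
    have -> : (t %/ 16 = \sum_(i < t | (i < t %/ 16)%N) 1)%N.
      by rewrite -(big_ord_widen t (fun=> 1%N)) ?leq_div // sum1_card card_ord.
    rewrite -sum1_card big_mkcond /= [X in (_ <= X)%N]big_mkcond /=.
    apply: leq_sum => i _; rewrite inE.
    by case: ifP => // it; rewrite leq_divRL // mulnC (ltnW it).
  by rewrite leq_divRL // mulnC.
have := card_coprime_pairs t; rewrite -/C.
have : (16 * (t * #|small|) <= t * t)%N by rewrite mulnCA leq_mul2l cs orbT.
by move: CB BG; rewrite !expnS expn0 muln1; lia.
Qed.

(** * The family of polynomials *)

Lemma Posz_exp (m k : nat) : Posz (m ^ k)%N = m%:Z ^+ k.
Proof. by elim: k => // k IHk; rewrite expnS PoszM IHk exprS. Qed.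

Lemma leq_exp_base (a b k : nat) : (a <= b)%N -> (a ^ k <= b ^ k)%N.
Proof. by case: k => // k ab; rewrite leq_exp2r. Qed.

(** With nonnegative coefficients [P(1)] is their sum, so the height can be estimated by evaluating
    the linear forms at 1. *)
Lemma nneg_height_bounds (P : {poly int}) (n : nat) :
  (forall i, 0 <= P`_i) -> size P = n.+1 ->
  (height P)%:Z <= P.[1] /\ P.[1] <= (n.+1 * height P)%N%:Z.
Proof.
move=> P0 sP; rewrite horner_coef.
under eq_bigr do rewrite expr1n mulr1.
have absP i : Posz (absz P`_i) = P`_i by rewrite gez0_abs.
have sumE : \sum_(i < size P) P`_i = Posz (\sum_(i < size P) absz (P`_i)%R)%N.
  by rewrite (big_morph Posz PoszD (erefl (Posz 0))); apply: eq_bigr => i _.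
rewrite sumE !lez_nat; split.
  by apply/bigmax_leqP => i _; rewrite (bigD1 i) //= leq_addr.
rewrite -[in X in (_ <= X)%N]sP -[X in (_ <= X * _)%N]card_ord -sum_nat_const.
by apply: leq_sum => i _; exact: (leq_bigmax (F := fun i : 'I_(size P) => absz P`_i)).
Qed.

(* The coefficients are those of a p-Eisenstein polynomial, with the free
   parameters e_i < E and a leading coefficient of size at least p E. *)
Definition eisenstein_coef (p n E : nat) (e : nat -> nat) (i : nat) : nat :=
  if i == n then (p * (E + e n)).+1
  else if i == 0%N then (p * (p * e 0%N).+1)%N else (p * e i)%N.

Lemma eisenstein_coef_lt (p n E : nat) (e : nat -> nat) : prime p ->
  forall i, (i < n)%N -> (p %| (eisenstein_coef p n E e i)%:Z)%Z.
Proof.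
move=> pp i iltn; rewrite /eisenstein_coef (ltn_eqF iltn) dvdzE /=.
by case: ifP => _; rewrite dvdn_mulr.
Qed.

Lemma eisenstein_coef_n (p n E : nat) (e : nat -> nat) : prime p ->
  ~~ (p %| (eisenstein_coef p n E e n)%:Z)%Z.
Proof.
move=> pp; rewrite /eisenstein_coef eqxx dvdzE /= -addn1 dvdn_addr ?dvdn_mulr //.
by rewrite Euclid_dvd1.
Qed.

Lemma eisenstein_coef_0 (p n E : nat) (e : nat -> nat) : prime p -> (0 < n)%N ->
  ~~ ((p ^ 2)%N %| (eisenstein_coef p n E e 0)%:Z)%Z.
Proof.
move=> pp n0; rewrite /eisenstein_coef (ltn_eqF n0) eqxx dvdzE /= expnS expn1.
rewrite dvdn_pmul2l ?prime_gt0 // -addn1 dvdn_addr ?dvdn_mulr //.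
by rewrite Euclid_dvd1.
Qed.

Lemma eisenstein_coef_inj (p n E : nat) (e e' : nat -> nat) : prime p ->
  (forall i, (i <= n)%N -> eisenstein_coef p n E e i = eisenstein_coef p n E e' i) ->
  forall i, (i <= n)%N -> e i = e' i.
Proof.
move=> pp ee i lein; have p0 := prime_gt0 pp.
have := ee i lein; rewrite /eisenstein_coef; case: eqP => [->|_].
  by move=> /eqP; rewrite eqSS eqn_pmul2l // eqn_add2l => /eqP.
case: eqP => [->|_] /eqP; last by rewrite eqn_pmul2l // => /eqP.
by rewrite eqn_pmul2l // eqSS eqn_pmul2l // => /eqP.
Qed.

Lemma eisenstein_coef_le (p n E : nat) (e : nat -> nat) (i : nat) : prime p ->
  (forall j, (e j < E)%N) -> (eisenstein_coef p n E e i <= 2 * p ^ 2 * E)%N.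
Proof.
move=> pp eE; have p1 := prime_gt1 pp.
rewrite /eisenstein_coef expnS expn1; case: eqP => _; first by have := eE n; nia.
by case: eqP => _; [have := eE 0%N; nia|have := eE i; nia].
Qed.

(** The two linear forms have determinant [t^2], the quotient [u2] being exact when [u] and [v] are
    coprime and [v > 0]. *)
Definition cluster_poly (p n t E u v : nat) (e : nat -> nat) : {poly int} :=
  let v2 := companion_entry (t ^ 2) u v in
  let u2 := ((v2 * u + t ^ 2) %/ v)%N in
  binform n (fun i => (eisenstein_coef p n E e i)%:Z)
    (v%:Z *: 'X + u%:Z%:P) (v2%:Z *: 'X + u2%:Z%:P).

Lemma companion_det (d u v : nat) : coprime u v -> (0 < v)%N ->
  v%:Z * ((companion_entry d u v * u + d) %/ v)%N%:Z
    - (companion_entry d u v)%:Z * u%:Z = d%:Z.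
Proof.
move=> cop v0; have [_ dv] := companion_entryP d cop v0.
by rewrite -PoszM mulnC divnK // PoszD PoszM addrAC subrr add0r.
Qed.

Lemma cluster_poly_clustered (p n k E u v : nat) (e : nat -> nat) :
  prime p -> (1 < n)%N -> coprime u v -> ~~ (p %| v)%N ->
  let P := cluster_poly p n (p ^ k) E u v e in
  [/\ size P = n.+1, irreducible_poly (map_poly intr P : {poly rat}) &
    exists2 D : int, D%:~R = discr P &
      D != 0 /\ ((p ^ (2 * k * (n * n.-1)))%N %| D)%Z].
Proof.
move=> pp n1 cop pv; have v0 : (0 < v)%N by case: v pv {cop}; rewrite ?dvdn0.
apply: binform_clustered => //.
- by rewrite companion_det // -Posz_exp -expnM mulnC.
- exact: eisenstein_coef_lt.
- exact: eisenstein_coef_n.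
- by apply: eisenstein_coef_0; rewrite // ltnW.
Qed.

Lemma cluster_poly_nneg (p n t E u v : nat) (e : nat -> nat) (i : nat) :
  0 <= (cluster_poly p n t E u v e)`_i.
Proof.
have mul_ge0 (A B : {poly int}) : (forall i, 0 <= A`_i) -> (forall i, 0 <= B`_i) ->
    forall i, 0 <= (A * B)`_i.
  by move=> A0 B0 j; rewrite coefM sumr_ge0 // => ? _; rewrite mulr_ge0.
have exp_ge0 (A : {poly int}) m : (forall i, 0 <= A`_i) -> forall i, 0 <= (A ^+ m)`_i.
  by move=> A0; elim: m => [|m IHm] j; [rewrite coef1; case: eqP|rewrite exprS mul_ge0].
have lin_ge0 (a b : nat) j : 0 <= (a%:Z *: 'X + b%:Z%:P)`_j.
  by rewrite coefD coefZ coefX coefC; case: j => [|[|j]]; rewrite /= ?mulr0 ?mulr1 ?add0r ?addr0.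
rewrite /cluster_poly /binform coef_sum sumr_ge0 // => j _.
by rewrite coefZ mulr_ge0 // mul_ge0 // => ?; apply: exp_ge0 => ?; exact: lin_ge0.
Qed.

Lemma horner1_cluster_poly (p n t E u v : nat) (e : nat -> nat) :
  (cluster_poly p n t E u v e).[1] = (\sum_(i < n.+1) eisenstein_coef p n E e i * ((v + u) ^ i *
    (companion_entry (t ^ 2) u v +
     (companion_entry (t ^ 2) u v * u + t ^ 2) %/ v) ^ (n - i)))%N%:Z.
Proof.
rewrite horner_binform (big_morph Posz PoszD (erefl (Posz 0))); apply: eq_bigr => i _.
by rewrite !(hornerD, hornerZ, hornerX, hornerC) !mulr1 !PoszM !Posz_exp !PoszD.
Qed.

Lemma cluster_poly_height_le (p n t E u v : nat) (e : nat -> nat) :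
  prime p -> coprime u v -> (0 < v)%N -> (u <= t)%N -> (v <= t)%N ->
  (t <= 16 * v)%N -> (forall i, (e i < E)%N) ->
  let P := cluster_poly p n t E u v e in size P = n.+1 ->
  (height P <= n.+1 * (2 * p ^ 2 * E * (18 * t) ^ n))%N.
Proof.
move=> pp cop v0 ut vt tv eE P sP.
have [hP _] := nneg_height_bounds (cluster_poly_nneg p n t E u v e) sP.
rewrite -lez_nat (le_trans hP) // horner1_cluster_poly lez_nat.
rewrite -[X in (_ <= X * _)%N](card_ord n.+1) -sum_nat_const; apply: leq_sum => i _.
rewrite leq_mul ?eisenstein_coef_le //.
have -> : ((18 * t) ^ n = (18 * t) ^ i * (18 * t) ^ (n - i))%N.
  by rewrite -expnD subnKC // -ltnS.
have [v2v dv] := companion_entryP (t ^ 2) cop v0.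
have u2E := divnK dv.
rewrite leq_mul // leq_exp_base //; first by lia.
move: u2E v2v; set v2 := companion_entry _ _ _; set u2 := (_ %/ v)%N => u2E v2v.
(* From [v u2 = v2 u + t^2], [v2 < v] and [t <= 16 v]. Then [v2 + u2 <= t + t + 16 t], whence the
   factor 18. *)
have : (u2 <= u + 16 * t)%N.
  rewrite -(leq_pmul2r v0) u2E mulnDl leq_add //; first by rewrite mulnC leq_mul2l ltnW ?orbT.
  by rewrite expnS expn1 -mulnA mulnCA leq_mul2l tv orbT.
by move: ut vt v2v; lia.
Qed.

(** The top term alone suffices: its coefficient is at least [E], and [u + v >= t / 16]. *)
Lemma cluster_poly_height_ge (p n t E u v : nat) (e : nat -> nat) :
  prime p -> (t <= 16 * v)%N ->
  let P := cluster_poly p n t E u v e in size P = n.+1 ->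
  (E * t ^ n <= 16 ^ n * (n.+1 * height P))%N.
Proof.
move=> pp tv P sP.
have [_ hP] := nneg_height_bounds (cluster_poly_nneg p n t E u v e) sP.
rewrite horner1_cluster_poly lez_nat in hP.
apply: leq_trans (leq_mul (leqnn _) hP).
rewrite big_ord_recr /= subnn expn0 muln1 mulnDr.
apply: leq_trans (leq_addl _ _); rewrite mulnCA -expnMn leq_mul //.
  by rewrite /eisenstein_coef eqxx; have := prime_gt0 pp; nia.
by rewrite leq_exp_base //; lia.
Qed.

Lemma absz_sub_lt (a b m : nat) :
  (0 < a <= m)%N -> (0 < b <= m)%N -> (absz (a%:Z - b%:Z) < m)%N.
Proof. lia. Qed.

(** The polynomial determines its disc, the disc determines the reduced fraction [u / v], and for
    fixed linear forms the coefficients are determined because the forms are independent. *)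
Lemma cluster_poly_inj (p n k E u v u' v' : nat) (e e' : nat -> nat) :
  prime p -> (1 < n)%N ->
  coprime u v -> ~~ (p %| v)%N -> (0 < u <= p ^ k)%N -> (v <= p ^ k)%N ->
  coprime u' v' -> ~~ (p %| v')%N -> (0 < u' <= p ^ k)%N -> (v' <= p ^ k)%N ->
  cluster_poly p n (p ^ k) E u v e = cluster_poly p n (p ^ k) E u' v' e' ->
  [/\ u = u', v = v' & forall i, (i <= n)%N -> e i = e' i].
Proof.
move=> pp n1 cop pv /andP[u0 ut] vt cop' pv' /andP[u0' ut'] vt' PP'.
have v0 : (0 < v)%N by case: (v) pv; rewrite ?dvdn0.
have v0' : (0 < v')%N by case: (v') pv'; rewrite ?dvdn0.
set t := (p ^ k)%N in ut vt ut' vt' PP' *.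
have tE : Posz (t ^ 2)%N = p%:Z ^+ (2 * k) by rewrite -Posz_exp /t -expnM mulnC.
have det := companion_det (t ^ 2) cop v0; have det' := companion_det (t ^ 2) cop' v0'.
have n0 := ltnW n1.
have pvz : ~~ (p %| v%:Z)%Z by rewrite dvdzE.
have pvz' : ~~ (p %| v'%:Z)%Z by rewrite dvdzE.
have [a ka] := exists_approx_root (2 * k) u pp pvz.
have ka' : (p%:Z ^+ (2 * k) %| v'%:Z * a + u')%Z.
  apply: (approx_root_of_dvdz_binform (b := fun i => (eisenstein_coef p n E e' i)%:Z)
    n0 pp pvz' (etrans det' tE)).
  - exact: eisenstein_coef_lt.
  - exact: eisenstein_coef_n.
  rewrite -[binform _ _ _ _]/(cluster_poly p n t E u' v' e') -PP'.
  exact: (dvdz_binform_approx_root n _ pp pvz (etrans det tE) ka).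
(* Eliminating [a] shows that [t^2] divides [u v' - u' v]; both products lie between 1 and [t^2], so
   the difference is smaller than [t^2] in absolute value and vanishes. *)
have cross : (u * v' = u' * v)%N.
  have : (Posz (t ^ 2)%N %| u%:Z * v' - u'%:Z * v)%Z.
    have -> : u%:Z * v' - u'%:Z * v = v'%:Z * (v%:Z * a + u) - v%:Z * (v'%:Z * a + u').
      by ring.
    by rewrite tE rpredB // dvdz_mull.
  rewrite dvdzE /=; have [/eqP|d0 /dvdn_leq] := eqVneq (u%:Z * v' - u'%:Z * v) 0.
    by rewrite subr_eq0 -!PoszM => /eqP[].
  rewrite absz_gt0 d0 -!PoszM leqNgt => /(_ isT) /negP[].
  by rewrite absz_sub_lt // muln_gt0 ?u0 ?u0' ?v0 ?v0' /= expnS expn1 leq_mul.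
have vv : v = v'.
  apply/eqP; rewrite eqn_dvd.
  rewrite -(Gauss_dvdr v' (_ : coprime v u)) ?cross ?dvdn_mull //; last by rewrite coprime_sym.
  by rewrite -(Gauss_dvdr v (_ : coprime v' u')) -?cross ?dvdn_mull // coprime_sym.
have uu : u = u' by apply/eqP; rewrite -(eqn_pmul2r v0) {1}vv cross.
split=> //; subst u' v'; apply: (eisenstein_coef_inj (E := E) pp) => i lein.
have t0 : Posz (t ^ 2)%N != 0 by rewrite eqz_nat expn_eq0 expn_eq0 -leqn0 leqNgt prime_gt0.
have vz0 : v%:Z != 0 by rewrite -lt0n.
have dz0 := t0; rewrite -det in dz0.
by have [] := binform_inj vz0 dz0 PP' lein.
Qed.

(** * Finiteness, choice of scales and the final count *)

Lemma finite_bounded_height (n N : nat) :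
  finite_set [set P : {poly int} | size P = n.+1 /\ (height P <= N)%N]%classic.
Proof.
(* Coefficients in [[-N, N]] are encoded as ordinals by adding [N]. *)
pose f (g : {ffun 'I_n.+1 -> 'I_(2 * N).+1}) : {poly int} :=
  \poly_(i < n.+1) ((g (inord i) : nat)%:Z - N%:Z).
apply: (@sub_finite_set _ _ (f @` setT)%classic); last first.
  by apply: finite_image; exact: finite_finset.
move=> P /= [sP hP].
have hi (i : nat) : (absz (P`_i)%R <= N)%N.
  have [iP|Pi] := ltnP i (size P); last by rewrite nth_default.
  apply: leq_trans hP.
  exact: (leq_bigmax (F := fun j : 'I_(size P) => absz P`_j) (Ordinal iP)).
exists [ffun i : 'I_n.+1 => inord (absz (P`_i + N%:Z)%R)] => //.
apply/polyP => i; rewrite coef_poly; case: ltnP => [lti|lei]; last first.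
  by rewrite nth_default // sP.
by rewrite ffunE !inordK //; have := hi i; lia.
Qed.

Lemma padic_abs_small (R : realType) (p N : nat) (D : int) : prime p ->
  D != 0 -> ((p ^ N)%N %| D)%Z -> 0 < padic_abs R p D <= p%:R ^- N.
Proof.
move=> pp D0 pD; rewrite /padic_abs (negPf D0).
have p0 : 0 < p%:R :> R by rewrite ltr0n prime_gt0.
rewrite invr_gt0 exprn_gt0 //= lef_pV2 ?posrE ?exprn_gt0 //.
rewrite ler_eXn2l ?ltr1n ?prime_gt1 //.
by rewrite -pfactor_dvdn // absz_gt0.
Qed.

(* Choice of the scales p^k ~ Q^(nu/(n(n-1))) and E ~ Q / p^(kn). *)
Lemma exists_scales (R : realType) (n p : nat) (nu Q : R) :
  (1 < n)%N -> prime p -> 0 <= nu <= n%:R - 1 -> 1 <= Q ->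
  let x := Q `^ (nu / (n%:R * (n%:R - 1))) in
  exists k E : nat, [/\ (0 < E)%N, (p ^ k)%:R <= x, x <= p%:R * (p ^ k)%:R,
    E%:R * (p ^ k)%:R ^+ n <= Q & Q <= 2 * (E%:R * (p ^ k)%:R ^+ n)].
Proof.
move=> n1 pp /andP[nu0 nun] Q1 x.
have Q0 : 0 <= Q by apply: le_trans Q1.
have nn0 : 0 < n%:R * (n%:R - 1) :> R.
  by rewrite mulr_gt0 ?ltr0n ?subr_gt0 ?ltr1n // ltnW.
have x1 : 1 <= x by rewrite -(powRr0 Q) ler_powR // divr_ge0 // ltW.
have x0 : 0 <= x by apply: le_trans x1.
(* The exponent of [Q] in [x^n] is [nu / (n-1) <= 1]; this is where [nu <= n - 1] enters, and it
   guarantees [E >= 1]. *)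
have xn : x ^+ n <= Q.
  rewrite -powR_mulrn // -powRrM -[leRHS]powRr1 // ler_powR //.
  rewrite mulrAC ler_pdivrMr // mul1r mulrC ler_pM2l ?ltr0n //.
  exact: ltnW.
have tx0 : (0 < Num.truncn x)%N by rewrite truncn_gt0.
pose k := trunc_log p (Num.truncn x).
have tx : (p ^ k)%:R <= x.
  have /andP[tl _] := truncn_itv x0; apply: le_trans tl.
  by rewrite ler_nat trunc_logP ?prime_gt1.
have t0 : 0 < (p ^ k)%:R :> R by rewrite ltr0n expn_gt0 prime_gt0.
have xt : x <= p%:R * (p ^ k)%:R.
  have /andP[_ /ltW tu] := truncn_itv x0; apply: le_trans tu _.
  by rewrite -natrM -expnS ler_nat trunc_log_ltn ?prime_gt1.
set t : R := (p ^ k)%:R in t0 tx xt *.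
have tn0 : 0 < t ^+ n by rewrite exprn_gt0.
have y1 : 1 <= Q / t ^+ n.
  rewrite ler_pdivlMr // mul1r; apply: le_trans xn.
  by rewrite lerXn2r ?nnegrE // ltW.
have y0 : 0 <= Q / t ^+ n by apply: le_trans y1.
exists k, (Num.truncn (Q / t ^+ n)).
have /andP[El Eu] := truncn_itv y0.
have E0 : (0 < Num.truncn (Q / t ^+ n))%N by rewrite truncn_gt0.
split=> //; first by rewrite -ler_pdivlMr.
rewrite mulrA -ler_pdivrMr // (le_trans (ltW Eu)) // -natrM ler_nat.
by rewrite mul2n -addnn -addn1 leq_add2l.
Qed.

Lemma scale_expn (R : realType) (n m : nat) (nu r Q : R) : 0 <= Q ->
  nu / (n%:R * (n%:R - 1)) * m%:R = r ->
  (Q `^ (nu / (n%:R * (n%:R - 1)))) ^+ m = Q `^ r.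
Proof. by move=> Q0 <-; rewrite -powR_mulrn ?powR_ge0 // -powRrM. Qed.

(** Raising [x <= p p^k] to the power [2n(n-1)] turns the left side into [Q^(2 nu)]; the loss of one
    factor [p] in the choice of [k] produces the constant [c0]. *)
Lemma scale_discr_bound (R : realType) (n p k : nat) (nu Q : R) :
  (1 < n)%N -> prime p -> 0 < Q ->
  Q `^ (nu / (n%:R * (n%:R - 1))) <= p%:R * (p ^ k)%:R ->
  p%:R ^- (2 * k * (n * n.-1)) <=
    p%:R ^+ (2 * (n * n.-1)) * Q `^ (- (2 * nu)) :> R.
Proof.
move=> n1 pp Q0; set x := Q `^ _ => xt.
have p0 : 0 < p%:R :> R by rewrite ltr0n prime_gt0.
have nn0 : n%:R * (n%:R - 1) != 0 :> R.
  by rewrite mulf_neq0 ?pnatr_eq0 -?lt0n ?subr_eq0 ?pnatr_eq1 ?gtn_eqF // ltnW.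
have xE : x ^+ (2 * (n * n.-1)) = Q `^ (2 * nu).
  apply: scale_expn; first exact: ltW.
  have -> : n.-1 = (n - 1)%N by rewrite subn1.
  by rewrite !natrM natrB 1?ltnW // mulrCA divfK // mulrC.
rewrite powRN -xE ler_pdivlMr ?exprn_gt0 ?powR_gt0 // mulrC.
rewrite ler_pdivrMr ?exprn_gt0 //.
have -> : p%:R ^+ (2 * (n * n.-1)) * p%:R ^+ (2 * k * (n * n.-1)) =
    (p%:R * (p ^ k)%:R) ^+ (2 * (n * n.-1)) :> R.
  rewrite exprMn natrX -exprM; congr (_ * _ ^+ _); lia.
by rewrite lerXn2r ?nnegrE ?powR_ge0 ?mulr_ge0.
Qed.

(** Since [n(n+1) = 2 + (n-1)(n+2)], the power [(E t^n)^(n+1)] is [E^(n+1) t^2] times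
    [t^((n-1)(n+2))]. The last factor is at most [Q^((n+2) nu / n)], and [t^2] is at most 16 times
    the number [g] of pairs. *)
Lemma scale_count_bound (R : realType) (n t E g : nat) (nu Q : R) :
  (1 < n)%N -> 0 < Q -> (0 < t)%N ->
  t%:R <= Q `^ (nu / (n%:R * (n%:R - 1))) ->
  Q <= 2 * (E%:R * t%:R ^+ n) -> (t ^ 2 <= 16 * g)%N ->
  (16 * 2 ^+ n.+1)^-1 * Q `^ (n%:R + 1 - (n%:R + 2) / n%:R * nu) <=
    (g * E ^ n.+1)%:R.
Proof.
move=> n1 Q0 t0; set x := Q `^ _ => tx QE tg.
have n0 : n%:R != 0 :> R by rewrite pnatr_eq0 -lt0n ltnW.
have n10 : n%:R - 1 != 0 :> R by rewrite subr_eq0 pnatr_eq1 gtn_eqF.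
have xE : x ^+ (n.-1 * n.+2) = Q `^ ((n%:R + 2) / n%:R * nu).
  apply: scale_expn; first exact: ltW.
  have -> : n.-1 = (n - 1)%N by rewrite subn1.
  by rewrite natrM natrB 1?ltnW // -addn2 natrD; field; rewrite n0 n10.
have x0 : 0 < x by rewrite powR_gt0.
rewrite powRB; last by rewrite (gt_eqF Q0) implybT.
rewrite natr1 powR_mulrn ?(ltW Q0) // -xE ler_pdivrMl ?mulr_gt0 ?exprn_gt0 //.
rewrite ler_pdivrMr ?exprn_gt0 //.
have Qn : Q ^+ n.+1 <= (2 * (E%:R * t%:R ^+ n)) ^+ n.+1.
  by rewrite lerXn2r ?nnegrE ?mulr_ge0 ?exprn_ge0 // ltW.
apply: (le_trans Qn).
have -> : (2 * (E%:R * t%:R ^+ n)) ^+ n.+1 =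
    2 ^+ n.+1 * E%:R ^+ n.+1 * t%:R ^+ 2 * t%:R ^+ (n.-1 * n.+2) :> R.
  have tE : (t%:R ^+ n) ^+ n.+1 = t%:R ^+ 2 * t%:R ^+ (n.-1 * n.+2) :> R.
    rewrite -exprM -exprD; congr (_ ^+ _).
    by case: n {xE QE Qn tx n0 n10 x x0} n1 => // m _ /=; lia.
  by rewrite !exprMn tE; ring.
rewrite ler_pM ?mulr_ge0 ?exprn_ge0 //; last by rewrite lerXn2r ?nnegrE // ltW.
have tg' : t%:R ^+ 2 <= 16 * g%:R :> R by rewrite -natrX -natrM ler_nat.
have -> : 16 * 2 ^+ n.+1 * (g * E ^ n.+1)%:R =
   2 ^+ n.+1 * E%:R ^+ n.+1 * (16 * g%:R) :> R by rewrite natrM natrX; ring.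
by rewrite ler_wpM2l ?mulr_ge0 ?exprn_ge0.
Qed.

Lemma cluster_poly_small_discr (R : realType) (n p k E u v : nat)
    (e : nat -> nat) (nu Q : R) :
  (1 < n)%N -> prime p -> 0 < Q ->
  Q `^ (nu / (n%:R * (n%:R - 1))) <= p%:R * (p ^ k)%:R ->
  E%:R * (p ^ k)%:R ^+ n <= Q -> Q <= 2 * (E%:R * (p ^ k)%:R ^+ n) ->
  coprime u v -> ~~ (p %| v)%N -> (u <= p ^ k)%N -> (v <= p ^ k)%N ->
  (p ^ k <= 16 * v)%N -> (forall i, (e i < E)%N) ->
  small_discr_polys n p (p%:R ^+ (2 * (n * n.-1)))
    (2 * 16 ^+ n * n.+1%:R)^-1 (n.+1 * (2 * p ^ 2 * 18 ^ n))%:R nu Q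
    (cluster_poly p n (p ^ k) E u v e).
Proof.
move=> n1 pp Q0 xt EQ QE cop pv ut vt tv eE.
have [sP irrP [D DE [D0 pD]]] := cluster_poly_clustered k E e pp n1 cop pv.
have v0 : (0 < v)%N by case: (v) pv; rewrite ?dvdn0.
have hle := cluster_poly_height_le pp cop v0 ut vt tv eE sP.
have hge := cluster_poly_height_ge pp tv sP.
set P := cluster_poly _ _ _ _ _ _ _ in sP irrP DE hle hge *.
set t := (p ^ k)%N in EQ QE hle hge *.
split=> //; last first.
  exists D => //; have /andP[-> Dle] := padic_abs_small R pp D0 pD.
  by rewrite (le_trans Dle) // scale_discr_bound.
(* The lower constant combines [Q <= 2 E t^n] with [E t^n <= 16^n (n+1) H]; the upper one combines
   the height bound with [E t^n <= Q]. *)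
apply/andP; split.
  rewrite ler_pdivrMl ?mulr_gt0 ?exprn_gt0 // (le_trans QE) // -!mulrA ler_pM2l //.
  by rewrite -!natrX -!natrM ler_nat.
apply: (@le_trans _ _ ((n.+1 * (2 * p ^ 2 * 18 ^ n))%:R * (E%:R * t%:R ^+ n))).
  rewrite -natrX -!natrM ler_nat (leq_trans hle) // expnMn.
  by apply: eq_leq; ring.
by rewrite ler_wpM2l.
Qed.

Unset Implicit Arguments.
Set Strict Implicit.

Theorem theorem3p1 (R : realType) (n p : nat) (hn : (2 <= n)%N)
    (hp : prime p) :
  exists c0 c1 c2 c3 : R,
    [/\ 0 < c0, 0 < c1, 0 < c2 & 0 < c3] /\
    forall nu : R, 0 <= nu <= n%:R - 1 ->
      \forall Q \near +oo,
        c3 * Q `^ (n%:R + 1 - (n%:R + 2) / n%:R * nu)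
          <= (#|` fset_set (small_discr_polys n p c0 c1 c2 nu Q)|%fset)%:R.
Proof.
have p0 := prime_gt0 hp.
exists (p%:R ^+ (2 * (n * n.-1))), (2 * 16 ^+ n * n.+1%:R)^-1,
  (n.+1 * (2 * p ^ 2 * 18 ^ n))%:R, (16 * 2 ^+ n.+1)^-1.
split.
  split; rewrite ?invr_gt0 ?mulr_gt0 ?exprn_gt0 ?ltr0n //.
  by rewrite !muln_gt0 !expn_gt0 p0.
move=> nu nu_int; near=> Q.
have Q1 : 1 <= Q by near: Q; exact: nbhs_pinfty_ge.
have Q0 : 0 < Q by apply: lt_le_trans Q1.
have [k [E [E0 tx xt EQ QE]]] := exists_scales hn hp nu_int Q1.
set A := small_discr_polys _ _ _ _ _ _ _.
(* Finiteness makes the cardinal of [fset_set A] the true count; it follows from the upper bound on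
   the height. *)
have finA : finite_set A.
  have [N QN] : exists N : nat, (n.+1 * (2 * p ^ 2 * 18 ^ n))%:R * Q <= N%:R.
    exists (Num.truncn ((n.+1 * (2 * p ^ 2 * 18 ^ n))%:R * Q)).+1.
    by rewrite ltW // truncnS_gt.
  apply: sub_finite_set (finite_bounded_height n N) => P [sP _ /andP[_ hP] _].
  by split=> //; rewrite -(ler_nat R) (le_trans hP).
set t := (p ^ k)%N in tx xt EQ QE.
(* The family is indexed by a good pair and [n + 1] free parameters below [E], hence has [g E^(n+1)]
   members for [g] good pairs. *)
pose f (w : ('I_t * 'I_t) * {ffun 'I_n.+1 -> 'I_E}) :=
  cluster_poly p n t E w.1.1.+1 w.1.2.+1 (fun i => w.2 (inord i)).
pose S := finset.setX (good_pairs p t) [set: {ffun 'I_n.+1 -> 'I_E}]%SET.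
have fA w : w \in S -> f w \in A.
  case: w => -[u v] e; rewrite !inE /= andbT => /and3P[cop pv tv].
  by apply/mem_set; apply: cluster_poly_small_discr.
have finj : {in S &, injective f}.
  move=> [[u v] e] [[u' v'] e']; rewrite !inE /= !andbT.
  move=> /and3P[cop pv tv] /and3P[cop' pv' tv'] ff.
  have [[/val_inj ->] [/val_inj ->] ee] := cluster_poly_inj hp hn cop pv (ltn_ord u)
    (ltn_ord v) cop' pv' (ltn_ord u') (ltn_ord v') ff.
  congr (_, _); apply/ffunP => i; apply: val_inj.
  by have := ee i (ltn_ord i); rewrite !inord_val.
have SA : (#|S| <= #|` fset_set A|)%N.
  have us : uniq [seq f w | w <- enum S].
    by rewrite map_inj_in_uniq ?enum_uniq // => ? ?; rewrite !mem_enum; exact: finj.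
  have sub : {subset [seq f w | w <- enum S] <= fset_set A}.
    by move=> y /mapP[w]; rewrite mem_enum => Sw ->; rewrite in_fset_set ?fA.
  by have := uniq_leq_size us sub; rewrite size_map -cardE.
apply: (@le_trans _ _ (#|S|)%:R); last by rewrite ler_nat.
rewrite /S cardsX cardsT card_ffun !card_ord.
apply: (@scale_count_bound _ _ t) => //; first by rewrite expn_gt0 p0.
exact: card_good_pairs.
Unshelve. all: by end_near. Qed.
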